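(* Let $1\le k\le n$ be integers and let $w=(w_1,\dots,w_n)$ be a vector of non-negative real numbers, at least $k$ of which are positive. Then for all increasing events $A,B\subset\{0,1\}^n$, $$P^w_{k,n}(A\,\square\,B)\le P^w_{k,n}(A)\,P^w_{k,n}(B).$$
   Context: Let $\Omega=\{0,1\}^n$ and $[n]=\{1,\dots,n\}$. For $\omega\in\Omega$ and $S\subset[n]$, write $\omega_S=(\omega_i)_{i\in S}$ and $[\omega]_S=\{\alpha\in\Omega:\alpha_S=\omega_S\}$. For $A,B\subset\Omega$, define $$A\,\square\,B=\{\omega\in\Omega:\ \text{there exist disjoint } K,L\subset[n]\text{ such that }[\omega]_K\subset A\text{ and }[\omega]_L\subset B\}.$$ For $\omega,\omega'\in\Omega$, write $\omega'\ge\omega$ if $\omega'_i\ge\omega_i$ for all $i\in[n]$. An event $A\subset\Omega$ is increasing if $\omega'\in A$ whenever $\omega\in A$ and $\omega'\ge\omega$. Let $\Omega_{k,n}$ be the set of all $\omega\in\Omega$ with exactly $k$ coordinates equal to $1$. The weighted $k$-out-of-$n$ measure (conditional Poisson measure) $P^w_{k,n}$ is the probability measure on $\Omega$ given by $$P^w_{k,n}(\omega)=C\,\mathrm{I}(\omega\in\Omega_{k,n})\prod_{i=1}^n w_i^{\omega_i},\qquad \omega\in\{0,1\}^n,$$ where $\mathrm{I}$ is the indicator function, $0^0=1$, and $C$ is the normalizing constant making $P^w_{k,n}$ a probability measure. *)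

(* Defs.v *)
(* The real numbers are an arbitrary [R : realType]. *)
From mathcomp Require Import all_boot all_order all_algebra.
From mathcomp Require Import reals.

Set Implicit Arguments.
Unset Strict Implicit.
Unset Printing Implicit Defensive.

Import Order.TTheory GRing.Theory Num.Theory.
Local Open Scope ring_scope.

(* The cube {0,1}^n; coordinates are 0, ..., n-1, and [true] stands for 1. *)
Definition cube (n : nat) := {ffun 'I_n -> bool}.

(* [omega]_S *)
Definition cylinder (n : nat) (omega : cube n) (S : {set 'I_n}) : {set cube n} :=
  [set alpha : cube n | [forall i in S, alpha i == omega i]].

Definition box (n : nat) (A B : {set cube n}) : {set cube n} :=
  [set omega : cube n |
    [exists K : {set 'I_n}, exists L : {set 'I_n},
      [&& [disjoint K & L], cylinder omega K \subset A
        & cylinder omega L \subset B]]].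

Definition increasing (n : nat) (A : {set cube n}) : Prop :=
  forall omega omega' : cube n,
    omega \in A -> (forall i, (omega i <= omega' i)%N) -> omega' \in A.

Definition k_out_of_n (k n : nat) : {set cube n} :=
  [set omega : cube n | #|[set i | omega i]| == k].

(* I(omega \in Omega_{k,n}) * \prod_i w_i^omega_i; here [0 ^+ 0 = 1]. *)
Definition cp_weight (R : realType) (k n : nat) (w : 'I_n -> R)
    (omega : cube n) : R :=
  (omega \in k_out_of_n k n)%:R * \prod_(i < n) w i ^+ omega i.

(* If fewer than k of the w_i are nonzero the sum vanishes and so does this
   constant; see [cp_measureT] for the meaningful case. *)
Definition cp_const (R : realType) (k n : nat) (w : 'I_n -> R) : R :=
  (\sum_(omega : cube n) cp_weight k w omega)^-1.

Definition cp_measure (R : realType) (k n : nat) (w : 'I_n -> R)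
    (A : {set cube n}) : R :=
  \sum_(omega in A) cp_const k w * cp_weight k w omega.

Lemma cp_weight_ge0 (R : realType) (k n : nat) (w : 'I_n -> R) (omega : cube n) :
  (forall i, 0 <= w i) -> 0 <= cp_weight k w omega.
Proof.
by move=> w0; rewrite mulr_ge0 ?ler0n// prodr_ge0 // => i _; rewrite exprn_ge0.
Qed.

Lemma cp_measureT (R : realType) (k n : nat) (w : 'I_n -> R) :
  (forall i, 0 <= w i) -> (k <= #|[set i | (0 < w i)%R]|)%N ->
  cp_measure k w [set: cube n] = 1.
Proof.
move=> w0 kw; rewrite /cp_measure -mulr_sumr.
under eq_bigl do rewrite inE.
rewrite /cp_const mulVf // gt_eqF //.
have /set0Pn[K] : [set K : {set 'I_n} | (K \subset [set i | (0 < w i)%R]) &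
    (#|K| == k)%N] != set0 by rewrite -card_gt0 cards_draws bin_gt0.
rewrite inE => /andP[/subsetP Kw Kk].
rewrite (bigD1 ([ffun i => i \in K] : cube n)) //= ltr_wpDr //.
  by apply: sumr_ge0 => omega _; exact: cp_weight_ge0.
rewrite /cp_weight inE.
have -> : [set i | [ffun i => i \in K] i] = K by apply/setP=> i; rewrite inE ffunE.
rewrite Kk mul1r prodr_gt0 // => i _; rewrite ffunE.
by case: (boolP (i \in K)) => [/Kw|_]; rewrite ?inE ?expr1 ?expr0.
Qed.

(* Main.v *)
Require Import Defs.
From mathcomp Require Import all_boot all_order all_algebra.
From mathcomp Require Import all_fingroup zify.
From mathcomp Require Import reals.

Set Implicit Arguments.
Unset Strict Implicit.
Unset Printing Implicit Defensive.

Import Order.TTheory GRing.Theory Num.Theory.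

Local Open Scope ring_scope.

(** Write the product [P(A) P(B)] as a sum over pairs of configurations
    [(x, y)], and group the pairs by the set [C] where both are [1] and the set
    [D] where they differ ([fold_pair]).  Within a group the weight of a pair is
    the constant [\prod_(i in C) w_i ^ 2 * \prod_(i in D) w_i] as soon as [x] and
    [y] both have [k] ones, so the weights drop out and the inequality becomes a
    counting statement on each group ([half_box]): among the subsets [X] of [D]
    with half of its elements, at most as many satisfy [C :|: X \in box A B] as
    satisfy both [C :|: X \in A] and [C :|: (D :\: X) \in B].

    For the counting, match the [2m] elements of [D] into [m] ordered pairs and
    consider only those [X] that choose one element from each pair.  They form a
    cube [{0,1}^m] in which complementation in [D] is the antipodal map.  For
    increasing events, witnesses of disjoint occurrence at [C :|: X] can be taken
    inside [C :|: X]; an element of [X] in a witness fixes the choice made in its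
    own pair, so disjoint witnesses give disjoint sets of pairs.  The restriction
    of [box A B] thus lies in the box of the restrictions of [A] and [B]
    ([reimer_transversal]), and the butterfly inequality of Reimer for uniform
    measure on the cube ([reimer]) applies.  The restricted events are no longer
    increasing, so that inequality is needed for arbitrary events.  Summing over
    all matchings finishes the argument, every half of [D] being a choice set
    equally often ([sum_pairings]).

    Reimer's inequality is proved by linear algebra.  Each [b] in [box A B] has a
    set [K] whose cylinder at [b] lies in [A] while that of the complement of [K]
    lies in [B].  Take the form [q] on functions on the cube that is the tensor
    power of the positive definite matrix with rows [(2, 1)] and [(1, 2)], and
    let [u_b] be the product function equal, in coordinate [i], to the indicator
    of [b_i] for [i] in [K], and otherwise to [1] at [b_i] and [-2] at its
    negation.  Then [u_b] is supported in [A], its image under [q] is supported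
    where the antipode is in [B], and [u_b] is congruent modulo 2 to the
    indicator of [b]; by the last point the [u_b] are linearly independent.
    A combination [f] of them that vanishes wherever [x \in A] and
    [flip x \in B] satisfies [q(f, f) = 0], hence is zero.  So the [u_b] restrict
    to independent functions on that set, which bounds their number by its
    cardinality. *)

(** * Reimer's inequality on the cube *)

Definition flip (m : nat) (x : cube m) : cube m := [ffun i => ~~ x i].

(** The tensor power of the matrix with rows [(2, 1)] and [(1, 2)]. *)
Definition qform (m : nat) (f g : cube m -> rat) : rat :=
  \sum_x \sum_y f x * g y * \prod_(i < m) (1 + (x i == y i)%:R).

(** The indicator of the subcube in which [z] prescribes the coordinates with
    value [Some t] and leaves free those with value [None]. *)
Definition slice_indicator (m : nat) (z : {ffun 'I_m -> option bool}) (x : cube m) :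
    rat :=
  \prod_(i < m) (if z i is Some t then (x i == t)%:R else 1).

(** In one coordinate, [1 + (s == t)] is the sum of [v s * v t] over three
    functions [v], namely the constant [1] and the two point indicators;
    distributing the product over coordinates gives the slices. *)
Lemma qform_sum_squares (m : nat) (f : cube m -> rat) :
  qform f f = \sum_z (\sum_x f x * slice_indicator z x) ^+ 2.
Proof.
have kernelE (x y : cube m) :
    \prod_(i < m) (1 + (x i == y i)%:R) =
    \sum_z slice_indicator z x * slice_indicator z y :> rat.
  pose e (t : bool) (c : option bool) : rat := if c is Some s then (t == s)%:R else 1.
  transitivity (\prod_(i < m) \sum_(c : option bool) e (x i) c * e (y i) c).
    apply: eq_bigr => i _.
    rewrite (bigD1 None) //= (bigD1 (Some true)) //= (bigD1 (Some false)) //=.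
    rewrite big1 => [|[[]|]] //; rewrite /e.
    by case: (x i); case: (y i).
  rewrite bigA_distr_bigA /=; apply: eq_bigr => z _.
  by rewrite big_split.
rewrite /qform; under eq_bigr do under eq_bigr do rewrite kernelE mulr_sumr.
under eq_bigr do rewrite exchange_big /=.
rewrite exchange_big /=; apply: eq_bigr => z _.
rewrite expr2 mulr_suml; apply: eq_bigr => x _.
by rewrite mulr_sumr; apply: eq_bigr => y _; rewrite mulrACA.
Qed.

(** The slice with all coordinates prescribed contributes [f x ^+ 2]. *)
Lemma qform_definite (m : nat) (f : cube m -> rat) :
  qform f f = 0 -> forall x, f x = 0.
Proof.
rewrite qform_sum_squares => /eqP.
rewrite psumr_eq0 => [/allP sq0 x|z _]; last exact: sqr_ge0.
have /implyP/(_ isT) := sq0 [ffun i => Some (x i)] (mem_index_enum _).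
rewrite sqrf_eq0 (bigD1 x) //= big1 ?addr0 => [|y neq_yx].
  by rewrite /slice_indicator big1 ?mulr1 => [/eqP //|i _]; rewrite ffunE eqxx.
suff -> : slice_indicator [ffun i => Some (x i)] y = 0 by rewrite mulr0.
have /existsP[i yxi] : [exists i, y i != x i].
  apply: contraNT neq_yx; rewrite negb_exists => /forallP yx.
  by apply/eqP/ffunP => i; apply/eqP; have := yx i; rewrite negbK.
by rewrite /slice_indicator (bigD1 i) //= ffunE (negbTE yxi) mul0r.
Qed.

(** An integer matrix that is the identity modulo 2 has odd determinant. *)
Lemma odd_matrix_unit (n : nat) (U : 'M[int]_n) :
    (forall i j, ((U i j)%:~R : 'F_2) = (i == j)%:R) ->
  (map_mx intr U : 'M[rat]_n) \in unitmx.
Proof.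
move=> Umod2; rewrite unitmxE unitfE det_map_mx intr_eq0.
have : ((\det U)%:~R : 'F_2) = 1.
  rewrite -(det_map_mx (intr : {rmorphism int -> 'F_2})) -(det1 _ n).
  by congr (\det _); apply/matrixP => i j; rewrite !mxE; exact: Umod2.
by apply: contra_eqN => /eqP->; rewrite eq_sym oner_eq0.
Qed.

(** The values [1] and [-2] off [K] serve two ends at once: modulo 2 they are the
    indicator of [b i], and [(1, -2)] is mapped by [((2, 1), (1, 2))] to
    [(0, -3)], which vanishes at [b i]. *)
Definition butterfly (m : nat) (b : cube m) (K : {set 'I_m}) (x : cube m) : int :=
  \prod_(i < m) (if i \in K then (x i == b i)%:R
                 else if x i == b i then 1 else - 2%:R).

Lemma butterfly_mod2 (m : nat) (b : cube m) (K : {set 'I_m}) (x : cube m) :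
  ((butterfly b K x)%:~R : 'F_2) = (x == b)%:R.
Proof.
transitivity (\prod_(i < m) (x i == b i)%:R : 'F_2).
  rewrite /butterfly rmorph_prod; apply: eq_bigr => i _ /=.
  case: (i \in K); case: (x i == b i) => //=.
  by apply/val_inj.
have [->|neq_xb] := eqVneq x b; first by rewrite big1 // => i _; rewrite eqxx.
have /existsP[i xbi] : [exists i, x i != b i].
  apply: contraNT neq_xb; rewrite negb_exists => /forallP xb.
  by apply/eqP/ffunP => i; apply/eqP; have := xb i; rewrite negbK.
by rewrite (bigD1 i) //= (negbTE xbi) mul0r.
Qed.

Lemma butterfly_support (m : nat) (b : cube m) (K : {set 'I_m}) (x : cube m) :
  butterfly b K x != 0 -> x \in cylinder b K.
Proof.
rewrite /butterfly inE => nz; apply/forall_inP => i Ki.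
by apply: contraNT nz => xbi; rewrite (bigD1 i) //= Ki (negbTE xbi) mul0r.
Qed.

Lemma butterfly_dual_support (m : nat) (b : cube m) (K : {set 'I_m}) (y : cube m) :
  \sum_x (butterfly b K x)%:~R * \prod_(i < m) (1 + (x i == y i)%:R) != 0 :> rat ->
  flip y \in cylinder b (~: K).
Proof.
pose e i t : rat := (if i \in K then (t == b i)%:R
  else if t == b i then 1 else - 2%:R) * (1 + (t == y i)%:R).
have -> : \sum_x (butterfly b K x)%:~R * \prod_(i < m) (1 + (x i == y i)%:R)
    = \prod_(i < m) \sum_(t : bool) e i t.
  rewrite bigA_distr_bigA; apply: eq_bigr => x _.
  rewrite big_split /= rmorph_prod; congr (_ * _); apply: eq_bigr => i _.
  by case: (i \in K); case: (x i == b i).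
move=> nz; rewrite inE; apply/forall_inP => i; rewrite inE ffunE => Ki.
apply: contraNT nz => yi; rewrite (bigD1 i) //= [X in X * _](_ : _ = 0) ?mul0r //.
rewrite big_bool /e (negbTE Ki).
by move: yi; case: (b i); case: (y i).
Qed.

(** The functions [u b] for [b] in [box A B], restricted to the right-hand set,
    are the rows of a matrix; its rows are shown to be independent. *)
Lemma reimer (m : nat) (A B : {set cube m}) :
  (#|box A B| <= #|[set y in A | flip y \in B]|)%N.
Proof.
set I := [set y in A | _].
have /fin_all_exists[K KP] (b : cube m) : exists K : {set 'I_m}, b \in box A B ->
    (cylinder b K \subset A) && (cylinder b (~: K) \subset B).
  have [|bn] := boolP (b \in box A B); last by exists set0.
  rewrite inE => /existsP[K /existsP[L /and3P[dKL KA LB]]].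
  exists K => _; rewrite KA; apply: subset_trans LB.
  apply/subsetP => x; rewrite !inE => /forall_inP xb; apply/forall_inP => i Li.
  by apply: xb; rewrite inE (disjointFl dKL).
pose u (b x : cube m) : rat := (butterfly b (K b) x)%:~R.
pose M : 'M[rat]_(#|box A B|, #|I|) := \matrix_(i, j) u (enum_val i) (enum_val j).
suff /eqP <- : row_free M by exact: rank_leq_col.
apply: inj_row_free => v vM0.
pose f x := \sum_i v 0 i * u (enum_val i) x.
have fI0 x : x \in I -> f x = 0.
  move=> Ix; transitivity ((v *m M) 0 (enum_rank_in Ix x)); last by rewrite vM0 mxE.
  by rewrite mxE; apply: eq_bigr => i _; rewrite mxE enum_rankK_in.
have fA x : x \notin A -> f x = 0.
  move=> Ax; apply: big1 => i _; apply/eqP; rewrite mulf_eq0 intr_eq0 orbC.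
  apply/orP; left; apply: contraNT Ax => /butterfly_support.
  by have /andP[/subsetP + _] := KP _ (enum_valP i); apply.
pose h y := \sum_x f x * \prod_(i < m) (1 + (x i == y i)%:R).
have hB y : flip y \notin B -> h y = 0.
  move=> By; transitivity (\sum_i v 0 i * \sum_x u (enum_val i) x *
      \prod_(l < m) (1 + (x l == y l)%:R)).
    under [RHS]eq_bigr do rewrite mulr_sumr.
    rewrite exchange_big; apply: eq_bigr => x _ /=.
    by rewrite mulr_suml; apply: eq_bigr => i _; rewrite mulrA.
  apply: big1 => i _; apply/eqP; rewrite mulf_eq0 orbC; apply/orP; left.
  apply: contraNT By => /butterfly_dual_support.
  by have /andP[_ /subsetP] := KP _ (enum_valP i); apply.
(* In [qform f f = \sum_y f y * h y], the factor [f y] vanishes outside [A] and on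
   [I], the factor [h y] where [flip y] is outside [B]: no term is left. *)
have f0 : forall x, f x = 0.
  apply: qform_definite; rewrite /qform exchange_big /=.
  apply: big1 => y _; transitivity (f y * h y).
    by rewrite mulr_sumr; apply: eq_bigr => x _; rewrite mulrA (mulrC (f y)).
  have [Ay|/fA->] := boolP (y \in A); last by rewrite mul0r.
  have [By|/hB->] := boolP (flip y \in B); last by rewrite mulr0.
  by rewrite fI0 ?mul0r // inE Ay.
(* Evaluating the rows of [M] as functions at the points of [box A B] gives a
   square matrix which is the identity modulo 2, so that [f = 0] forces [v = 0]. *)
pose U : 'M[int]_#|box A B| :=
  \matrix_(i, j) butterfly (enum_val i) (K (enum_val i)) (enum_val j).
have Uunit : (map_mx intr U : 'M[rat]_#|box A B|) \in unitmx.
  apply: odd_matrix_unit => i j; rewrite mxE butterfly_mod2 eq_sym.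
  by rewrite (inj_eq enum_val_inj).
apply: (can_inj (mulmxK Uunit)); rewrite mul0mx; apply/rowP => j.
by rewrite !mxE -[RHS](f0 (enum_val j)); apply: eq_bigr => i _; rewrite !mxE.
Qed.

(** * Restriction to the transversals of a matching *)

Definition config (n : nat) (X : {set 'I_n}) : cube n := [ffun i => i \in X].

Lemma increasing_config (n : nat) (A : {set cube n}) (X Y : {set 'I_n}) :
  increasing A -> X \subset Y -> config X \in A -> config Y \in A.
Proof.
move=> incA /subsetP sXY AX; apply: incA AX _ => i; rewrite !ffunE.
by case: (boolP (i \in X)) => // /sXY ->.
Qed.

(** The configuration [config (X :&: K)] agrees with [config X] on [K] and so lies
    in the cylinder of a witness [K].  For increasing events it is as good as the
    cylinder, since every configuration above it is in the event too. *)
Lemma box_config (n : nat) (A B : {set cube n}) (X : {set 'I_n}) :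
    config X \in box A B ->
  exists K L : {set 'I_n}, [/\ [disjoint K & L], K \subset X, L \subset X,
    config K \in A & config L \in B].
Proof.
rewrite inE => /existsP[K /existsP[L /and3P[dKL /subsetP KA /subsetP LB]]].
exists (X :&: K), (X :&: L); split; rewrite ?subsetIl //.
- by rewrite (disjointW _ _ dKL) ?subsetIr.
- by apply: KA; rewrite inE; apply/forall_inP => i Ki; rewrite !ffunE inE Ki andbT.
- by apply: LB; rewrite inE; apply/forall_inP => i Li; rewrite !ffunE inE Li andbT.
Qed.

(** [g] lists the matched pairs [{g (i, true), g (i, false)}], and [a] chooses an
    element from each. *)
Definition transversal (m n : nat) (g : {ffun 'I_m * bool -> 'I_n}) (a : cube m) :
  {set 'I_n} := [set g (i, a i) | i : 'I_m].

(** A witness [K] contained in [C :|: transversal g a] is translated into the set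
    of indices of the pairs whose chosen element it uses.  Fixing these choices
    keeps [K] inside the configuration, and since every pair has exactly one
    chosen element, disjoint witnesses use disjoint sets of indices. *)
Lemma reimer_transversal (m n : nat) (g : {ffun 'I_m * bool -> 'I_n})
    (C : {set 'I_n}) (A B : {set cube n}) :
    injective g -> increasing A -> increasing B ->
  (#|[set a | config (C :|: transversal g a) \in box A B]| <=
   #|[set a | (config (C :|: transversal g a) \in A) &&
              (config (C :|: transversal g (flip a)) \in B)]|)%N.
Proof.
move=> g_inj incA incB.
pose A' := [set a | config (C :|: transversal g a) \in A].
pose B' := [set a | config (C :|: transversal g a) \in B].
have -> : [set a | (config (C :|: transversal g a) \in A) &&
    (config (C :|: transversal g (flip a)) \in B)] = [set a in A' | flip a \in B'].
  by apply/setP => a; rewrite !inE.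
apply: leq_trans (reimer A' B'); apply/subset_leq_card/subsetP => a.
rewrite [in X in X -> _]inE => /box_config[K [L [dKL KX LX AK BL]]].
pose used (S : {set 'I_n}) := [set i | g (i, a i) \in S].
have used_cylinder (S : {set 'I_n}) (E : {set cube n}) : increasing E ->
    S \subset C :|: transversal g a -> config S \in E ->
    cylinder a (used S) \subset [set a | config (C :|: transversal g a) \in E].
  move=> incE /subsetP SX ES; apply/subsetP => a'; rewrite !inE => /forall_inP a'a.
  apply: increasing_config ES => //; apply/subsetP => j Sj; rewrite inE.
  have := SX j Sj; rewrite inE => /orP[-> //|/imsetP[i _ jE]].
  apply/orP; right; apply/imsetP; exists i => //.
  by rewrite (eqP (a'a i _)) // inE -jE.
rewrite inE; apply/existsP; exists (used K); apply/existsP; exists (used L).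
rewrite !used_cylinder // !andbT.
apply/pred0P => i; rewrite /= !inE; apply/negP => /andP[Ki Li].
by have := disjointFr dKL Ki; rewrite Li.
Qed.

(** * Averaging over all matchings of a set *)

(** Swapping a point of [X :\: Y] with a point of [Y :\: X] decreases [X :\: Y]. *)
Lemma exists_perm_imset (T : finType) (D X Y : {set T}) :
    X \subset D -> Y \subset D -> #|X| = #|Y| ->
  exists s : {perm T}, s @: X = Y /\ s @: D = D.
Proof.
have [k] := ubnP #|X :\: Y|; elim: k X => // k IHk X ltk sXD sYD eqXY.
have [sXY|] := boolP (X \subset Y).
  exists 1%g; split; last by apply/setP => x; apply/imsetP/idP => [[y ? ->]|];
    [rewrite perm1 | exists x; rewrite ?perm1].
  have -> : Y = X by apply/esym/eqP; rewrite eqEcard sXY eqXY /=.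
  by apply/setP => x; apply/imsetP/idP => [[y ? ->]|];
    [rewrite perm1 | exists x; rewrite ?perm1].
case/subsetPn => x Xx Yx.
have /subsetPn[y Yy Xy] : ~~ (Y \subset X).
  apply: contra Yx => sYX; suff -> : Y = X by [].
  by apply/eqP; rewrite eqEcard sYX eqXY /=.
have [Dx Dy] := (subsetP sXD x Xx, subsetP sYD y Yy).
pose t := tperm x y.
have tmem (S : {set T}) z : (z \in t @: S) = (t z \in S).
  by rewrite -{1}(tpermK x y z) mem_imset //; exact: perm_inj.
have tD : t @: D = D.
  by apply/setP => z; rewrite tmem /t; case: tpermP => [->|->|]; rewrite ?Dx ?Dy.
have [||||s [sX sD]] := IHk (t @: X).
- rewrite ltnS in ltk; apply: leq_trans ltk; apply/proper_card/properP; split.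
    apply/subsetP => z; rewrite !inE tmem /t; case: tpermP => [->|->|//].
      by rewrite (negbTE Xy) andbF.
    by rewrite Yy.
  exists x; first by rewrite inE Yx.
  by rewrite inE tmem /t tpermL (negbTE Xy) andbF.
- by rewrite -tD imsetS.
- by [].
- by rewrite card_imset //; exact: perm_inj.
exists (t * s)%g; split.
  by rewrite -sX -imset_comp; apply: eq_imset => z; rewrite /= permM.
by rewrite -[RHS]sD -{2}tD -imset_comp; apply: eq_imset => z; rewrite /= permM.
Qed.

(** Each matching of [D] is listed once for every order of its pairs and of the
    two elements in each pair; only the uniformity of the counts matters. *)
Definition pairings (m n : nat) (D : {set 'I_n}) : {set {ffun 'I_m * bool -> 'I_n}} :=
  [set g : {ffun 'I_m * bool -> 'I_n} | injectiveb g & g @: [set: 'I_m * bool] == D].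

Lemma card_transversal (m n : nat) (D : {set 'I_n})
    (g : {ffun 'I_m * bool -> 'I_n}) (a : cube m) :
  g \in pairings m D -> #|transversal g a| = m.
Proof.
rewrite inE => /andP[/injectiveP g_inj _].
by rewrite card_imset ?card_ord // => i j /g_inj[].
Qed.

Lemma transversal_sub (m n : nat) (D : {set 'I_n})
    (g : {ffun 'I_m * bool -> 'I_n}) (a : cube m) :
  g \in pairings m D -> transversal g a \subset D.
Proof.
rewrite inE => /andP[_ /eqP<-]; apply/subsetP => _ /imsetP[i _ ->].
exact: imset_f.
Qed.

Lemma transversal_flip (m n : nat) (D : {set 'I_n})
    (g : {ffun 'I_m * bool -> 'I_n}) (a : cube m) :
  g \in pairings m D -> transversal g (flip a) = D :\: transversal g a.
Proof.
rewrite inE => /andP[/injectiveP g_inj /eqP<-]; apply/setP => j; rewrite inE.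
apply/imsetP/andP => [[i _ ->]|[njX /imsetP[[i b] _ jE]]].
  split; last exact: imset_f.
  by apply/imsetP => -[i' _ /g_inj[<-]]; rewrite ffunE; case: (a i).
exists i => //; rewrite ffunE jE; congr (g (i, _)).
apply: contraNeq njX => neq; rewrite jE; apply/imsetP; exists i => //.
by congr (g (i, _)); move: neq; case: (b); case: (a i).
Qed.

(** How often [X] arises as a choice set. *)
Definition pairing_count (m n : nat) (D X : {set 'I_n}) : nat :=
  #|[set q : {ffun 'I_m * bool -> 'I_n} * cube m |
      (q.1 \in pairings m D) && (transversal q.1 q.2 == X)]|.

(** Composing matchings with a permutation of [D] that sends [X] to [Y] is
    injective.  Exchanging [X] and [Y] shows that the count depends only on the
    cardinality. *)
Lemma pairing_count_le (m n : nat) (D X Y : {set 'I_n}) :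
  X \subset D -> Y \subset D -> #|X| = #|Y| ->
  (pairing_count m D X <= pairing_count m D Y)%N.
Proof.
move=> sXD sYD eqXY; have [s [sX sD]] := exists_perm_imset sXD sYD eqXY.
pose act (q : {ffun 'I_m * bool -> 'I_n} * cube m) := ([ffun p => s (q.1 p)], q.2).
have act_inj : injective act.
  move=> [g a] [h b] [/ffunP gh ->]; congr (_, _); apply/ffunP => p.
  by have := gh p; rewrite !ffunE => /perm_inj.
rewrite /pairing_count -(card_imset _ act_inj); apply/subset_leq_card/subsetP.
move=> _ /imsetP[[g a] + ->]; rewrite !inE /=.
move=> /andP[/andP[/injectiveP g_inj /eqP gD] /eqP gX].
apply/andP; split; first (apply/andP; split).
- by apply/injectiveP => p q; rewrite !ffunE => /perm_inj/g_inj.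
- by rewrite -sD -gD -imset_comp; apply/eqP/eq_imset => p; rewrite ffunE.
- by rewrite -sX -gX -imset_comp; apply/eqP/eq_imset => i; rewrite ffunE.
Qed.

Lemma pairing_count_gt0 (m n : nat) (D X : {set 'I_n}) :
  X \subset D -> #|X| = m -> #|D :\: X| = m -> (0 < pairing_count m D X)%N.
Proof.
move=> sXD Xm Ym; rewrite card_gt0; apply/set0Pn.
pose h (p : 'I_m * bool) := if p.2 then enum_val (cast_ord (esym Xm) p.1)
                             else enum_val (cast_ord (esym Ym) p.1).
have hX i : h (i, true) \in X by exact: enum_valP.
have hY i : h (i, false) \in D :\: X by exact: enum_valP.
have h_inj : injective h.
  move=> [i b] [j c] /[dup] eqh; have := (hX i, hX j, hY i, hY j); rewrite !inE.
  case: b c eqh => [] [] eqh [[[Xi Xj] /andP[Yi _]] /andP[Yj _]].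
  - by have /enum_val_inj/cast_ord_inj /= -> := eqh.
  - by rewrite -eqh Xi in Yj.
  - by rewrite eqh Xj in Yi.
  - by have /enum_val_inj/cast_ord_inj /= -> := eqh.
exists (finfun h, [ffun=> true]); rewrite !inE /=.
apply/andP; split; first (apply/andP; split).
- by apply/injectiveP => p q; rewrite !ffunE => /h_inj.
- rewrite eqEcard; apply/andP; split.
    apply/subsetP => _ /imsetP[[i []] _ ->]; rewrite ffunE.
      exact: (subsetP sXD).
    by have := hY i; rewrite inE => /andP[].
  rewrite card_imset => [|p q]; last by rewrite !ffunE => /h_inj.
  rewrite cardsT card_prod card_bool card_ord muln2 -addnn -(cardsID X D) (setIidPr sXD).
  by rewrite Xm Ym.
- rewrite eqEcard; apply/andP; split.
    by apply/subsetP => _ /imsetP[i _ ->]; rewrite !ffunE.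
  by rewrite card_imset ?card_ord ?Xm // => i j; rewrite !ffunE => /h_inj[].
Qed.

(** Double counting of matchings with a choice set satisfying [P]. *)
Lemma sum_pairings (m n : nat) (D X0 : {set 'I_n}) (P : pred {set 'I_n}) :
    X0 \subset D -> #|X0| = m ->
  (\sum_(g in pairings m D) #|[set a : cube m | P (transversal g a)]| =
   pairing_count m D X0 * #|[set X : {set 'I_n} | [&& X \subset D, #|X| == m & P X]]|)%N.
Proof.
move=> sX0 X0m.
under eq_bigr do rewrite -sum1dep_card.
rewrite pair_big_dep /=.
pose Q (X : {set 'I_n}) := [&& X \subset D, #|X| == m & P X].
rewrite (partition_big (fun q => transversal q.1 q.2) Q) /=; last first.
  move=> [g a] /= /andP[gD Pga].
  by rewrite /Q (transversal_sub a gD) (card_transversal a gD) eqxx.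
rewrite mulnC -sum1dep_card big_distrl /=; apply: eq_bigr => X /and3P[sX /eqP Xm PX].
rewrite mul1n sum1dep_card; transitivity (pairing_count m D X).
  apply: eq_card => -[g a]; rewrite [in LHS]inE [in RHS]inE /=.
  case: (transversal g a =P X) => [->|]; rewrite ?andbF //.
  by rewrite PX !andbT.
by apply/eqP; rewrite eqn_leq !pairing_count_le // ?Xm ?X0m.
Qed.

(** By [sum_pairings] both sides, multiplied by the same positive count, are sums
    over matchings, which [reimer_transversal] compares term by term. *)
Lemma half_box (m n : nat) (C D : {set 'I_n}) (A B : {set cube n}) :
    increasing A -> increasing B -> #|D| = m.*2 ->
  (#|[set X : {set 'I_n} | [&& X \subset D, #|X| == m
                             & config (C :|: X) \in box A B]]| <=
   #|[set X : {set 'I_n} | [&& X \subset D, #|X| == m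
      & (config (C :|: X) \in A) && (config (C :|: (D :\: X)) \in B)]]|)%N.
Proof.
move=> incA incB Dm.
have [->|/set0Pn[X0]] := eqVneq [set X : {set 'I_n} | [&& X \subset D, #|X| == m
                             & config (C :|: X) \in box A B]] set0.
  by rewrite cards0.
rewrite inE => /and3P[sX0 /eqP X0m _].
have X0'm : #|D :\: X0| = m.
  by rewrite cardsD (setIidPr sX0) X0m Dm -addnn addnK.
rewrite -(leq_pmul2l (pairing_count_gt0 sX0 X0m X0'm)).
rewrite -(sum_pairings (fun X : {set 'I_n} => config (C :|: X) \in box A B)) //.
rewrite -(sum_pairings (fun X : {set 'I_n} => (config (C :|: X) \in A) &&
  (config (C :|: (D :\: X)) \in B))) //.
apply: leq_sum => g gD.
have g_inj : injective g by move: gD; rewrite inE => /andP[/injectiveP].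
apply: leq_trans (reimer_transversal C g_inj incA incB) _.
by apply/subset_leq_card/subsetP => a; rewrite !inE (transversal_flip a gD).
Qed.

(** * Folding pairs of configurations *)

Lemma cp_weight_config (R : realType) (k n : nat) (w : 'I_n -> R) (X : {set 'I_n}) :
  cp_weight k w (config X) = (#|X| == k)%:R * \prod_(i in X) w i.
Proof.
rewrite /cp_weight inE; congr ((_ == _)%:R * _).
  by congr #|pred_of_set _|; apply/setP => i; rewrite inE ffunE.
rewrite [RHS]big_mkcond; apply: eq_bigr => i _; rewrite ffunE.
by case: (i \in X).
Qed.

(** The data that determine a pair of configurations up to the way in which the
    ones in the differing coordinates are shared out. *)
Definition fold_pair (n : nat) (p : cube n * cube n) : {set 'I_n} * {set 'I_n} :=
  ([set i | p.1 i && p.2 i], [set i | p.1 i != p.2 i]).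

Lemma sum_fold (R : realType) (n : nat) (C D : {set 'I_n})
    (F : cube n * cube n -> R) : [disjoint C & D] ->
  \sum_(p | fold_pair p == (C, D)) F p =
  \sum_(X : {set 'I_n} | X \subset D) F (config (C :|: X), config (C :|: (D :\: X))).
Proof.
move=> dCD.
rewrite (reindex_onto (fun X : {set 'I_n} => (config (C :|: X), config (C :|: (D :\: X))))
  (fun p => [set i in D | p.1 i])) /=.
  apply: eq_bigl => X; apply/andP/idP => [[_ /eqP<-]|sXD].
    by apply/subsetP => i; rewrite inE => /andP[].
  have CX i : i \in C -> (i \in D = false) * (i \in X = false).
    move=> Ci; have Di := disjointFr dCD Ci; split=> //.
    by apply/negP => /(subsetP sXD); rewrite Di.
  split; last first.
    apply/eqP/setP => i; rewrite !inE ffunE inE.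
    case: (boolP (i \in C)) => [/CX[-> ->] //|_].
    by apply/andP/idP => [[]//|Xi]; rewrite (subsetP sXD).
  apply/eqP; congr (_, _); apply/setP => i; rewrite !inE !ffunE !inE.
    by case: (i \in C); case: (i \in X); case: (i \in D).
  case: (boolP (i \in C)) => [/CX[-> ->] //|_].
  by have := subsetP sXD i; case: (i \in X); case: (i \in D) => //; move=> /(_ isT).
move=> [x y] /eqP[<- <-]; congr (_, _); apply/ffunP => i; rewrite !ffunE !inE /=;
  by case: (x i); case: (y i).
Qed.

(** On a fibre of [fold_pair], two configurations with [k] ones have a constant
    product of weights, and each contains half of [D]; apart from this constant
    factor the two sums are the cardinalities in [half_box]. *)
Lemma cp_box_fold (R : realType) (k n : nat) (w : 'I_n -> R) (A B : {set cube n})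
    (CD : {set 'I_n} * {set 'I_n}) :
    (forall i, 0 <= w i) -> increasing A -> increasing B ->
  \sum_(p | fold_pair p == CD)
     cp_weight k w p.1 * cp_weight k w p.2 * (p.1 \in box A B)%:R <=
  \sum_(p | fold_pair p == CD)
     cp_weight k w p.1 * cp_weight k w p.2 * ((p.1 \in A) && (p.2 \in B))%:R.
Proof.
case: CD => C D w0 incA incB.
have [dCD|nCD] := boolP [disjoint C & D]; last first.
  rewrite !big_pred0 // => p; apply: contraNF nCD => /eqP[<- <-];
    by apply/pred0P => i; rewrite /= !inE; case: (p.1 i); case: (p.2 i).
rewrite !sum_fold //=.
pose c : R := (\prod_(i in C) w i) ^+ 2 * \prod_(i in D) w i.
have c_ge0 : 0 <= c by rewrite mulr_ge0 ?sqr_ge0 // prodr_ge0.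
have weightE (X : {set 'I_n}) : X \subset D ->
    cp_weight k w (config (C :|: X)) * cp_weight k w (config (C :|: (D :\: X))) =
    ((#|C| + #|X| == k)%N && (#|C| + #|D :\: X| == k)%N)%:R * c.
  move=> sXD; rewrite !cp_weight_config.
  have dCX : [disjoint C & X] by exact: disjointWr dCD.
  have dCY : [disjoint C & D :\: X] by apply: disjointWr dCD; exact: subsetDl.
  have cardU (Y : {set 'I_n}) : [disjoint C & Y] -> (#|C :|: Y| = #|C| + #|Y|)%N.
    by move=> /disjoint_setI0 dCY'; rewrite cardsU dCY' cards0 subn0.
  have prodU (Y : {set 'I_n}) : [disjoint C & Y] ->
      \prod_(i in C :|: Y) w i = \prod_(i in C) w i * \prod_(i in Y) w i.
    by move=> dCY'; rewrite -bigU //; apply: eq_bigl => i; rewrite !inE.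
  rewrite !cardU // !prodU // mulrACA -natrM mulnb; congr (_ * _).
  by rewrite mulrACA -expr2 /c (big_setID (A := D) X) (setIidPr sXD).
have fiberE (P : pred {set 'I_n}) : \sum_(X : {set 'I_n} | X \subset D)
    cp_weight k w (config (C :|: X)) * cp_weight k w (config (C :|: (D :\: X))) *
    (P X)%:R =
  c * #|[set X : {set 'I_n} | [&& X \subset D,
     (#|C| + #|X| == k)%N && (#|C| + #|D :\: X| == k)%N & P X]]|%:R.
  rewrite -sum1dep_card natr_sum mulr_sumr big_mkcondr /=.
  apply: eq_bigr => X sXD; rewrite weightE //.
  by case: (_ && _); case: (P X); rewrite /= ?mul1r ?mulr1 ?mulr0 ?mul0r.
rewrite (fiberE (fun X => config (C :|: X) \in box A B)).
rewrite (fiberE (fun X => (config (C :|: X) \in A) && (config (C :|: (D :\: X)) \in B))).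
rewrite ler_wpM2l // ler_nat.
set S := [set X | _]; have [->|/set0Pn[X0]] := eqVneq S set0; first by rewrite cards0.
rewrite inE => /and3P[sX0 /andP[/eqP CX0 /eqP CX0'] _].
have Dm : #|D| = (#|X0|).*2.
  by rewrite -(cardsID X0 D) (setIidPr sX0) -addnn; lia.
have halfE (X : {set 'I_n}) : X \subset D ->
    (#|C| + #|X| == k)%N && (#|C| + #|D :\: X| == k)%N = (#|X| == #|X0|).
  move=> sX; have := cardsID X D; rewrite (setIidPr sX) Dm -addnn => DX.
  by apply/andP/eqP => [[/eqP ? _]|?]; [lia | split; apply/eqP; lia].
suff -> : S = [set X : {set 'I_n} | [&& X \subset D, #|X| == #|X0|
                              & config (C :|: X) \in box A B]].
  apply: leq_trans (half_box C incA incB Dm) _.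
  apply/subset_leq_card/subsetP => X; rewrite !inE => /andP[sX].
  by rewrite halfE ?sX.
apply/setP => X; rewrite !inE.
by have [sX|//] := boolP (X \subset D); rewrite halfE.
Qed.

Theorem mainTheorem2 (R : realType) (k n : nat) (w : 'I_n -> R)
    (hk : (1 <= k)%N) (hkn : (k <= n)%N)
    (w_ge0 : forall i : 'I_n, 0 <= w i)
    (w_pos : (k <= #|[set i : 'I_n | (0 < w i)%R]|)%N)
    (A B : {set cube n}) (incA : increasing A) (incB : increasing B) :
  cp_measure k w (box A B) <= cp_measure k w A * cp_measure k w B.
Proof.
pose S (E : {set cube n}) := \sum_(x in E) cp_weight k w x.
have measureE (E : {set cube n}) : cp_measure k w E = cp_const k w * S E.
  by rewrite /cp_measure mulr_sumr.
have const_ge0 : 0 <= cp_const k w.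
  by rewrite invr_ge0 sumr_ge0 // => x _; exact: cp_weight_ge0.
have total : cp_const k w * S setT = 1 by rewrite -measureE cp_measureT.
have productE (E F : {set cube n}) : S E * S F = \sum_(p : cube n * cube n)
    cp_weight k w p.1 * cp_weight k w p.2 * ((p.1 \in E) && (p.2 \in F))%:R.
  rewrite /S mulr_suml; under eq_bigr do rewrite mulr_sumr.
  rewrite pair_big big_mkcond; apply: eq_bigr => p _ /=.
  by case: ifP; rewrite ?mulr1 ?mulr0.
(* The left-hand side also runs over pairs, with no condition on the second
   component, so that it can be compared fibre by fibre. *)
have key : S (box A B) * S setT <= S A * S B.
  rewrite !productE (partition_big (@fold_pair n) xpredT) //=.
  rewrite [leRHS](partition_big (@fold_pair n) xpredT) //=.
  apply: ler_sum => CD _; under eq_bigr do rewrite in_setT andbT.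
  exact: cp_box_fold.
rewrite !measureE -[leLHS]mulr1 -total mulrACA [leRHS]mulrACA.
by rewrite ler_wpM2l ?mulr_ge0.
Qed.
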